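(* Let $(\mathbb{T},\tau,\kappa)$ be a lax monoidal powerset-enriched monad on $\mathsf{Set}$. With $E:=(1,\eta_1)$, the triple $(\mathsf{Mon}(\mathsf{Set}_{\mathbb{T}}),\boxtimes,E)$ is a monoidal category whose underlying structure maps (associativity and unit isomorphisms) are those of the cartesian structure of $\mathsf{Set}$.
   Context: **Induced orders.** $\mathbb{P}=(P,\bigcup,\{-\})$ is the powerset monad on $\mathsf{Set}$, and $\mathbb{T}=(T,\mu,\eta)$ is a monad on $\mathsf{Set}$ with a monad morphism $\tau:\mathbb{P}\to\mathbb{T}$. Each set $TX$ carries the induced complete lattice order whose suprema are given by $\bigvee A=\mu_X(\tau_{TX}(A))$ for $A\subseteq TX$ (so $\mathfrak{x}\le \mathfrak{y}\iff \mu_X(\tau_{TX}(\{\mathfrak{x},\mathfrak{y}\}))=\mathfrak{y}$). Sets of maps into an ordered set are ordered pointwise. **Powerset-enriched monad.** $(\mathbb{T},\tau)$ is powerset-enriched if for all sets $X,Y$ and maps $f,g:X\to TY$, $f\le g$ implies $\mu_Y\cdot Tf\le\mu_Y\cdot Tg$. **$\mathbb{T}$-monoids.** Objects of $\mathsf{Mon}(\mathsf{Set}_{\mathbb{T}})$ are pairs $(X,\alpha)$ with $X$ a set and $\alpha:X\to TX$ a map with $\eta_X\le\alpha$ and $\mu_X\cdot T\alpha\cdot\alpha\le\alpha$; a homomorphism $f:(X,\alpha)\to(Y,\beta)$ is a map $f:X\to Y$ with $Tf\cdot\alpha\le\beta\cdot f$. **Lax monoidal.** Let $1=\{\star\}$,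 let $\upsilon_{X,Y,Z}:X\times(Y\times Z)\to(X\times Y)\times Z$, $\lambda_X:X\to X\times 1$, $\rho_X:X\to 1\times X$ be the canonical bijections (forming the cartesian structure of $\mathsf{Set}$), and let $\pi_{X,Y}:PX\times PY\to P(X\times Y)$, $\pi_{X,Y}(A,B)=A\times B$. A powerset-enriched monad $(\mathbb{T},\tau)$ with a family of maps $\kappa_{X,Y}:TX\times TY\to T(X\times Y)$ natural in $X$ and $Y$ is lax monoidal if: - $\kappa_{X\times Y,Z}\cdot(\kappa_{X,Y}\times 1_{TZ})\cdot\upsilon_{TX,TY,TZ}=T\upsilon_{X,Y,Z}\cdot\kappa_{X,Y\times Z}\cdot(1_{TX}\times\kappa_{Y,Z})$; - $\kappa_{X,1}\cdot(1_{TX}\times\eta_1)\cdot\lambda_{TX}=T\lambda_X$ and $\kappa_{1,X}\cdot(\eta_1\times1_{TX})\cdot\rho_{TX}=T\rho_X$; - $\eta_{X\times Y}\le\kappa_{X,Y}\cdot(\eta_X\times\eta_Y)$; - $\mu_{X\times Y}\cdot T\kappa_{X,Y}\cdot\kappa_{TX,TY}\le\kappa_{X,Y}\cdot(\mu_X\times\mu_Y)$; - $\tau_{X\times Y}\cdot\pi_{X,Y}\le\kappa_{X,Y}\cdot(\tau_X\times\tau_Y)$. **Box product.** $(X,\alpha)\boxtimes(Y,\beta)=(X\times Y,\ \kappa_{X,Y}\cdot(\alpha\times\beta))$, with $f\boxtimes g=f\times g$ on homomorphisms. *)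

(* Defs.v *)
From mathcomp Require Import all_boot.
From mathcomp Require Import boolp classical_sets.

Set Implicit Arguments.
Unset Strict Implicit.
Unset Printing Implicit Defensive.

Local Open Scope classical_set_scope.

(* The category of sets is that of types and functions; by functional         *)
(* extensionality, equality of maps is Leibniz equality of functions.         *)

Definition prodf {X X' Y Y' : Type} (f : X -> X') (g : Y -> Y')
  (p : X * Y) : X' * Y' := (f p.1, g p.2).

Definition upsilon (X Y Z : Type) (p : X * (Y * Z)) : (X * Y) * Z :=
  ((p.1, p.2.1), p.2.2).

Definition lambda (X : Type) (x : X) : X * unit := (x, tt).

Definition rho (X : Type) (x : X) : unit * X := (tt, x).

Record monad := Monad {
  mfun :> Type -> Type;
  fmap : forall X Y : Type, (X -> Y) -> mfun X -> mfun Y;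
  eta : forall X : Type, X -> mfun X;
  mu : forall X : Type, mfun (mfun X) -> mfun X;
  fmap_id : forall X : Type, fmap (@id X) = id;
  fmap_comp : forall (X Y Z : Type) (g : Y -> Z) (f : X -> Y),
    fmap (g \o f) = fmap g \o fmap f;
  eta_nat : forall (X Y : Type) (f : X -> Y), fmap f \o @eta X = @eta Y \o f;
  mu_nat : forall (X Y : Type) (f : X -> Y),
    fmap f \o @mu X = @mu Y \o fmap (fmap f);
  mu_eta : forall X : Type, @mu X \o @eta (mfun X) = id;
  mu_fmap_eta : forall X : Type, @mu X \o fmap (@eta X) = id;
  mu_mu : forall X : Type, @mu X \o @mu (mfun X) = @mu X \o fmap (@mu X) }.

Arguments fmap m {X Y} f _.
Arguments eta m X _ : clear implicits.
Arguments mu m X _ : clear implicits.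

Section PowersetMonad.
Implicit Types X Y Z : Type.

Definition pow_map X Y (f : X -> Y) (A : set X) : set Y := f @` A.
Definition pow_eta X (x : X) : set X := [set x].
Definition pow_mu X (S : set (set X)) : set X := \bigcup_(A in S) A.

Lemma pow_map_id X : pow_map (@id X) = id.
Proof. by apply: funext => A; exact: image_id. Qed.

Lemma pow_map_comp X Y Z (g : Y -> Z) (f : X -> Y) :
  pow_map (g \o f) = pow_map g \o pow_map f.
Proof. by apply: funext => A; rewrite /pow_map /= image_comp. Qed.

Lemma pow_eta_nat X Y (f : X -> Y) :
  pow_map f \o @pow_eta X = @pow_eta Y \o f.
Proof. by apply: funext => x; exact: image_set1. Qed.

Lemma pow_mu_nat X Y (f : X -> Y) :
  pow_map f \o @pow_mu X = @pow_mu Y \o pow_map (pow_map f).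
Proof.
by apply: funext => S; rewrite /pow_map /pow_mu /= image_bigcup bigcup_image.
Qed.

Lemma pow_mu_eta X : @pow_mu X \o @pow_eta (set X) = id.
Proof. by apply: funext => A; exact: bigcup_set1. Qed.

Lemma pow_mu_map_eta X : @pow_mu X \o pow_map (@pow_eta X) = id.
Proof.
apply: funext => A; rewrite /pow_mu /pow_map /= bigcup_image.
by apply/seteqP; split => [x [y Ay ->]|x Ax] //; exists x.
Qed.

Lemma pow_mu_mu X :
  @pow_mu X \o @pow_mu (set X) = @pow_mu X \o pow_map (@pow_mu X).
Proof.
by apply: funext => S; rewrite /pow_mu /pow_map /= bigcup_image bigcup_bigcup.
Qed.

End PowersetMonad.

Definition powerset_monad : monad :=
  Monad pow_map_id pow_map_comp pow_eta_nat pow_mu_nat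
        pow_mu_eta pow_mu_map_eta pow_mu_mu.

Record monad_morphism (S T : monad) := MonadMorphism {
  mm :> forall X : Type, S X -> T X;
  mm_nat : forall (X Y : Type) (f : X -> Y),
    fmap T f \o @mm X = @mm Y \o fmap S f;
  mm_eta : forall X : Type, @mm X \o eta S X = eta T X;
  mm_mu : forall X : Type,
    @mm X \o mu S X = mu T X \o @mm (T X) \o fmap S (@mm X) }.

Arguments mm {S T} m X _.

Section InducedOrder.
Variables (T : monad) (tau : monad_morphism powerset_monad T).

Definition Tsup (X : Type) (A : set (T X)) : T X := mu T X (tau (T X) A).

Definition Tle (X : Type) (x y : T X) : Prop := Tsup [set x; y] = y.

Definition fun_le (X Y : Type) (f g : X -> T Y) : Prop :=
  forall x : X, Tle (f x) (g x).

Definition powerset_enriched : Prop :=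
  forall (X Y : Type) (f g : X -> T Y), fun_le f g ->
    fun_le (mu T Y \o fmap T f) (mu T Y \o fmap T g).

Definition is_Tmonoid (X : Type) (a : X -> T X) : Prop :=
  fun_le (eta T X) a /\ fun_le (mu T X \o fmap T a \o a) a.

Definition is_Thom (X Y : Type) (a : X -> T X) (b : Y -> T Y) (f : X -> Y) :
    Prop :=
  fun_le (fmap T f \o a) (b \o f).

Record Tmonoid := MkTmonoid {
  carrier :> Type;
  str : carrier -> T carrier;
  strP : is_Tmonoid str }.

Record Thom (A B : Tmonoid) := MkThom {
  Thom_fun :> A -> B;
  ThomP : is_Thom (@str A) (@str B) Thom_fun }.

Lemma Tsup1 X (x : T X) : Tsup [set x] = x.
Proof.
rewrite /Tsup; have /= := congr1 (@^~ x) (mm_eta tau (T X)) => ->.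
exact: (congr1 (@^~ x) (mu_eta T X)).
Qed.

Lemma Tsup_bigcup X (S : set (set (T X))) :
  Tsup (@Tsup X @` S) = Tsup (\bigcup_(A in S) A).
Proof.
rewrite /Tsup; have /= := congr1 (@^~ S) (mm_mu tau (T X)).
rewrite /pow_mu /pow_map => ->.
have /= -> := congr1 (@^~ (tau (T (T X)) (tau (T X) @` S))) (mu_mu T X).
congr (mu T X _).
have /= -> := congr1 (@^~ (tau (T X) @` S)) (mm_nat tau (mu T X)).
by rewrite /pow_map image_comp.
Qed.

Lemma fmap_Tsup X Y (f : X -> Y) (A : set (T X)) :
  fmap T f (Tsup A) = Tsup (fmap T f @` A).
Proof.
rewrite /Tsup; have /= -> := congr1 (@^~ (tau (T X) A)) (mu_nat T f).
by have /= -> := congr1 (@^~ A) (mm_nat tau (fmap T f)).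
Qed.

Lemma Tle_refl X (x : T X) : Tle x x.
Proof. by rewrite /Tle setUid Tsup1. Qed.

Lemma Tle_trans X (y x z : T X) : Tle x y -> Tle y z -> Tle x z.
Proof.
have supU (A B : set (T X)) : Tsup [set Tsup A; Tsup B] = Tsup (A `|` B).
  by rewrite -!image_set1 -image_setU Tsup_bigcup bigcup_setU !bigcup_set1.
rewrite /Tle => xy yz; rewrite -{1}yz -{1}(Tsup1 x) supU setUA.
by rewrite -supU xy Tsup1.
Qed.

Lemma fmap_Tle X Y (f : X -> Y) (x y : T X) :
  Tle x y -> Tle (fmap T f x) (fmap T f y).
Proof.
by rewrite /Tle => {2}<-; rewrite fmap_Tsup image_setU !image_set1.
Qed.

Lemma is_Thom_id (A : Tmonoid) : is_Thom (@str A) (@str A) id.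
Proof. by move=> x; rewrite /= fmap_id; exact: Tle_refl. Qed.

Lemma is_Thom_comp (A B C : Tmonoid) (g : Thom B C) (f : Thom A B) :
  is_Thom (@str A) (@str C) (g \o f).
Proof.
move=> x; rewrite /= fmap_comp /=.
by apply: Tle_trans (ThomP g (f x)); apply: fmap_Tle; exact: (ThomP f x).
Qed.

Definition Thom_id (A : Tmonoid) : Thom A A := MkThom (@is_Thom_id A).

Definition Thom_comp (A B C : Tmonoid) (g : Thom B C) (f : Thom A B) :
  Thom A C := MkThom (is_Thom_comp g f).

Lemma Thom_eq (A B : Tmonoid) (f g : Thom A B) :
  Thom_fun f = Thom_fun g -> f = g.
Proof.
case: f g => [f fP] [g gP] /= e; case: _ / e gP => gP.
by rewrite (Prop_irrelevance fP gP).
Qed.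

End InducedOrder.

Arguments str {T tau} t _.

Record category := Category {
  Obj :> Type;
  Hom : Obj -> Obj -> Type;
  cid : forall A : Obj, Hom A A;
  ccomp : forall A B C : Obj, Hom B C -> Hom A B -> Hom A C;
  ccompA : forall (A B C D : Obj) (h : Hom C D) (g : Hom B C) (f : Hom A B),
    ccomp h (ccomp g f) = ccomp (ccomp h g) f;
  ccomp1f : forall (A B : Obj) (f : Hom A B), ccomp (cid B) f = f;
  ccompf1 : forall (A B : Obj) (f : Hom A B), ccomp f (cid A) = f }.

Arguments Hom {c} A B.
Arguments cid {c} A.
Arguments ccomp {c A B C} g f.

Definition is_iso (C : category) (A B : C) (f : Hom A B) : Prop :=
  exists g : Hom B A, ccomp g f = cid A /\ ccomp f g = cid B.

(* The structure maps point in the directions of upsilon, lambda and rho; in  *)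
(* particular [l A : A -> ten A E] and [r A : A -> ten E A].                  *)
Record is_monoidal (C : category)
    (ten : C -> C -> C)
    (tenf : forall {A A' B B' : C},
      Hom A A' -> Hom B B' -> Hom (ten A B) (ten A' B'))
    (E : C)
    (a : forall A B D : C, Hom (ten A (ten B D)) (ten (ten A B) D))
    (l : forall A : C, Hom A (ten A E))
    (r : forall A : C, Hom A (ten E A)) : Prop := IsMonoidal {
  tenf_id : forall A B : C, tenf (cid A) (cid B) = cid (ten A B);
  tenf_comp : forall (A A' A'' B B' B'' : C)
      (f' : Hom A' A'') (f : Hom A A') (g' : Hom B' B'') (g : Hom B B'),
    tenf (ccomp f' f) (ccomp g' g) = ccomp (tenf f' g') (tenf f g);
  a_nat : forall (A A' B B' D D' : C)
      (f : Hom A A') (g : Hom B B') (h : Hom D D'),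
    ccomp (a A' B' D') (tenf f (tenf g h)) =
    ccomp (tenf (tenf f g) h) (a A B D);
  l_nat : forall (A A' : C) (f : Hom A A'),
    ccomp (l A') f = ccomp (tenf f (cid E)) (l A);
  r_nat : forall (A A' : C) (f : Hom A A'),
    ccomp (r A') f = ccomp (tenf (cid E) f) (r A);
  a_iso : forall A B D : C, is_iso (a A B D);
  l_iso : forall A : C, is_iso (l A);
  r_iso : forall A : C, is_iso (r A);
  pentagon : forall A B D F : C,
    ccomp (a (ten A B) D F) (a A B (ten D F)) =
    ccomp (tenf (a A B D) (cid F))
      (ccomp (a A (ten B D) F) (tenf (cid A) (a B D F)));
  triangle : forall A B : C,
    ccomp (a A E B) (tenf (cid A) (r B)) = tenf (l A) (cid B) }.

Definition Mon (T : monad) (tau : monad_morphism powerset_monad T) : category.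
Proof.
refine (@Category (Tmonoid tau) (@Thom T tau) (@Thom_id T tau)
                  (@Thom_comp T tau) _ _ _).
- by move=> A B C D h g f; exact: Thom_eq.
- by move=> A B f; exact: Thom_eq.
- by move=> A B f; exact: Thom_eq.
Defined.

Definition pow_prod (X Y : Type) (p : set X * set Y) : set (X * Y) :=
  p.1 `*` p.2.

Record lax_monoidal (T : monad) (tau : monad_morphism powerset_monad T)
    (kappa : forall X Y : Type, T X * T Y -> T (X * Y)%type) : Prop :=
  LaxMonoidal {
  kappa_nat : forall (X X' Y Y' : Type) (f : X -> X') (g : Y -> Y'),
    fmap T (prodf f g) \o kappa X Y =
    kappa X' Y' \o prodf (fmap T f) (fmap T g);
  kappa_upsilon : forall X Y Z : Type,
    kappa (X * Y)%type Z \o prodf (kappa X Y) id \o @upsilon (T X) (T Y) (T Z) =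
    fmap T (@upsilon X Y Z) \o kappa X (Y * Z)%type \o prodf id (kappa Y Z);
  kappa_lambda : forall X : Type,
    kappa X unit \o prodf id (eta T unit) \o @lambda (T X) =
    fmap T (@lambda X);
  kappa_rho : forall X : Type,
    kappa unit X \o prodf (eta T unit) id \o @rho (T X) = fmap T (@rho X);
  kappa_eta : forall X Y : Type,
    fun_le tau (eta T (X * Y)%type) (kappa X Y \o prodf (eta T X) (eta T Y));
  kappa_mu : forall X Y : Type,
    fun_le tau
      (mu T (X * Y)%type \o fmap T (kappa X Y) \o kappa (T X) (T Y))
      (kappa X Y \o prodf (mu T X) (mu T Y));
  kappa_tau : forall X Y : Type,
    fun_le tau (tau (X * Y)%type \o @pow_prod X Y)
      (kappa X Y \o prodf (tau X) (tau Y)) }.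

(* Only the map of the box product: that it is a T-monoid structure uses the  *)
(* axioms on kappa.                                                           *)
Definition box_str (T : monad) (tau : monad_morphism powerset_monad T)
    (kappa : forall X Y : Type, T X * T Y -> T (X * Y)%type)
    (A B : Tmonoid tau) : A * B -> T (A * B)%type :=
  kappa A B \o prodf (str A) (str B).

(* Main.v *)
Require Import Defs.
From mathcomp Require Import all_boot.
From mathcomp Require Import boolp classical_sets.

Set Implicit Arguments.
Unset Strict Implicit.
Unset Printing Implicit Defensive.

(** The heart of the matter is that [kappa] is monotone for the induced order.
    A sup in [T X] is [mu] applied to a value of [tau], so the axioms
    [kappa_tau] and [kappa_mu], read in sequence, bound
    [kappa (Tsup A, Tsup B)] from below by the sup of [kappa] over [A `*` B]
    ([kappa_Tsup]); for [A = [set x; x']] and [B = [set y; y']] with [x <= x']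
    and [y <= y'] this says that [kappa (x, y) <= kappa (x', y')]
    ([kappa_mono]).

    Monotonicity carries over to the box product every inequality that holds
    factorwise: the monoid laws follow from [kappa_eta] and [kappa_mu]
    ([box_strP]), and products of homomorphisms are homomorphisms by
    naturality ([prodf_Thom]).  The axioms [kappa_upsilon], [kappa_lambda] and
    [kappa_rho] make the cartesian structure maps commute with the monoid
    structures on the nose.  Such a map with an inverse function is an
    isomorphism of monoids ([strict_iso]).  As homomorphisms are determined by
    their underlying functions, the naturality squares and coherence diagrams
    are those of the cartesian structure of sets. *)

(** * The induced order *)

Section InducedOrderTheory.
Local Open Scope classical_set_scope.
Variables (T : monad) (tau : monad_morphism powerset_monad T).

Lemma Tle_Tsup X (A : set (T X)) x : A x -> Tle tau x (Tsup tau A).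
Proof.
move=> Ax; rewrite /Tle.
have -> : [set x; Tsup tau A] = @Tsup T tau X @` [set [set x]; A].
  by rewrite image_setU !image_set1 Tsup1.
rewrite Tsup_bigcup bigcup_setU !bigcup_set1; congr (Tsup tau _).
by apply/setUidPr => y ->.
Qed.

(** By associativity, [mu T X] is a morphism of algebras from the free algebra
    on [T X] to the free algebra on [X]; sups being computed by the algebra
    structure along the natural [tau], it preserves them. *)
Lemma mu_Tsup X (S : set (T (T X))) :
  mu T X (Tsup tau S) = Tsup tau (mu T X @` S).
Proof.
rewrite /Tsup; have /= -> := congr1 (@^~ (tau (T (T X)) S)) (mu_mu T X).
by have /= -> := congr1 (@^~ S) (mm_nat tau (mu T X)).
Qed.

Lemma mu_Tle X (x y : T (T X)) :
  Tle tau x y -> Tle tau (mu T X x) (mu T X y).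
Proof. by rewrite /Tle => {2}<-; rewrite mu_Tsup image_setU !image_set1. Qed.

Lemma unit_strP X : is_Tmonoid tau (eta T X).
Proof.
split=> x; first exact: Tle_refl.
have /= -> := congr1 (@^~ (eta T X x)) (mu_fmap_eta T X).
exact: Tle_refl.
Qed.

Lemma strict_Thom X Y (a : X -> T X) (b : Y -> T Y) (f : X -> Y) :
  fmap T f \o a = b \o f -> is_Thom tau a b f.
Proof. by move=> fab x; rewrite fab; exact: Tle_refl. Qed.

(** A bijective homomorphism need not be invertible, since the inverse may
    reverse the lax inequality; equality in the homomorphism law does pass to
    the inverse. *)
Lemma strict_iso (A B : Tmonoid tau) (f : Thom A B) (g : B -> A) :
  fmap T f \o str A = str B \o f -> cancel f g -> cancel g f ->
  is_iso (C := Mon tau) (A := A) (B := B) f.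
Proof.
move=> fab fK gK.
have gba : fmap T g \o str B = str A \o g.
  apply: funext => y /=; rewrite -{1}(gK y).
  have /= <- := congr1 (@^~ (g y)) fab.
  have /= <- := congr1 (@^~ (str A (g y))) (fmap_comp T g f).
  by have -> : g \o f = id; [exact: funext | rewrite fmap_id].
by exists (MkThom (strict_Thom gba)); split; apply: Thom_eq; apply: funext.
Qed.

End InducedOrderTheory.

(** * Monotonicity of [kappa] and the box product *)

Section BoxProduct.
Local Open Scope classical_set_scope.
Variables (T : monad) (tau : monad_morphism powerset_monad T).
Variable kappa : forall X Y : Type, T X * T Y -> T (X * Y)%type.
Arguments kappa : clear implicits.
Hypothesis hkappa : lax_monoidal tau kappa.

(** The sups on the right are [mu] of values of [tau]: [kappa_mu] pulls [kappa]
    inside both copies of [mu], where [kappa_tau] compares it with [tau] of the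
    rectangle, and naturality of [tau] yields the image under [kappa]. *)
Lemma kappa_Tsup X Y (A : set (T X)) (B : set (T Y)) :
  Tle tau (Tsup tau (kappa X Y @` (A `*` B)))
          (kappa X Y (Tsup tau A, Tsup tau B)).
Proof.
apply: Tle_trans (kappa_mu hkappa (tau (T X) A, tau (T Y) B)).
rewrite /Tsup.
have /= <- := congr1 (@^~ (A `*` B)) (mm_nat tau (kappa X Y)).
apply: mu_Tle; apply: fmap_Tle; exact: (kappa_tau hkappa (A, B)).
Qed.

Lemma kappa_mono X Y (x x' : T X) (y y' : T Y) :
  Tle tau x x' -> Tle tau y y' ->
  Tle tau (kappa X Y (x, y)) (kappa X Y (x', y')).
Proof.
(* [x <= x'] is by definition the equation [Tsup [set x; x'] = x']. *)
move=> xx' yy'; rewrite -xx' -yy'.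
apply: Tle_trans (kappa_Tsup _ _); apply: Tle_Tsup.
by exists (x, y) => //; split; left.
Qed.

Lemma box_strP (A B : Tmonoid tau) :
  is_Tmonoid tau (box_str kappa (A := A) (B := B)).
Proof.
have [etaA muA] := strP A; have [etaB muB] := strP B.
split=> -[x y].
  apply: Tle_trans (kappa_eta hkappa (x, y)) _.
  by apply: kappa_mono; [exact: etaA | exact: etaB].
rewrite /box_str /= fmap_comp /=.
have /= -> := congr1 (@^~ (str A x, str B y))
  (kappa_nat hkappa (str A) (str B)).
apply: Tle_trans
  (kappa_mu hkappa (fmap T (str A) (str A x), fmap T (str B) (str B y))) _.
by apply: kappa_mono; [exact: muA | exact: muB].
Qed.

Lemma prodf_Thom (A A' B B' : Tmonoid tau) (f : Thom A A') (g : Thom B B') :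
  is_Thom tau (box_str kappa (A := A) (B := B))
              (box_str kappa (A := A') (B := B')) (prodf f g).
Proof.
move=> [x y]; rewrite /box_str /=.
have /= -> := congr1 (@^~ (str A x, str B y)) (kappa_nat hkappa f g).
by apply: kappa_mono; [exact: (ThomP f x) | exact: (ThomP g y)].
Qed.

Definition box (A B : Tmonoid tau) : Tmonoid tau := MkTmonoid (box_strP A B).

Definition unit_Tmonoid : Tmonoid tau := MkTmonoid (unit_strP tau unit).

Lemma upsilon_strict (A B C : Tmonoid tau) :
  fmap T (@upsilon A B C) \o str (box A (box B C)) =
  str (box (box A B) C) \o @upsilon A B C.
Proof.
apply: funext => -[x [y z]].
exact: (esym (congr1 (@^~ (str A x, (str B y, str C z)))
  (kappa_upsilon hkappa A B C))).
Qed.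

Lemma lambda_strict (A : Tmonoid tau) :
  fmap T (@lambda A) \o str A = str (box A unit_Tmonoid) \o @lambda A.
Proof.
by apply: funext => x; exact: (esym (congr1 (@^~ (str A x))
  (kappa_lambda hkappa A))).
Qed.

Lemma rho_strict (A : Tmonoid tau) :
  fmap T (@rho A) \o str A = str (box unit_Tmonoid A) \o @rho A.
Proof.
by apply: funext => x; exact: (esym (congr1 (@^~ (str A x))
  (kappa_rho hkappa A))).
Qed.

End BoxProduct.

(** * The monoidal category *)

Theorem proposition2p6p3
  (T : monad) (tau : monad_morphism powerset_monad T)
  (kappa : forall X Y : Type, T X * T Y -> T (X * Y)%type)
  (hT : powerset_enriched tau) (hkappa : lax_monoidal tau kappa) :
  exists box_monoid : forall A B : Tmonoid tau,
    is_Tmonoid tau (box_str kappa (A := A) (B := B)),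
  exists unit_monoid : is_Tmonoid tau (eta T unit),
  let box (A B : Tmonoid tau) : Tmonoid tau := MkTmonoid (box_monoid A B) in
  let E : Tmonoid tau := MkTmonoid unit_monoid in
  exists box_hom : forall (A A' B B' : Tmonoid tau)
      (f : Thom A A') (g : Thom B B'),
    is_Thom tau (str (box A B)) (str (box A' B')) (prodf f g),
  exists upsilon_hom : forall A B C : Tmonoid tau,
    is_Thom tau (str (box A (box B C))) (str (box (box A B) C))
      (@upsilon A B C),
  exists lambda_hom : forall A : Tmonoid tau,
    is_Thom tau (str A) (str (box A E)) (@lambda A),
  exists rho_hom : forall A : Tmonoid tau,
    is_Thom tau (str A) (str (box E A)) (@rho A),
  is_monoidal (C := Mon tau) (ten := box)
    (fun A A' B B' f g => MkThom (box_hom A A' B B' f g))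
    (E := E)
    (fun A B C => MkThom (upsilon_hom A B C))
    (fun A => MkThom (lambda_hom A))
    (fun A => MkThom (rho_hom A)).
Proof.
exists (box_strP hkappa), (unit_strP tau unit) => box0 E.
exists (prodf_Thom hkappa).
exists (fun A B C => strict_Thom tau (upsilon_strict hkappa A B C)).
exists (fun A => strict_Thom tau (lambda_strict hkappa A)).
exists (fun A => strict_Thom tau (rho_strict hkappa A)).
split.
- by move=> A B; apply: Thom_eq; apply: funext => -[].
- by move=> *; exact: Thom_eq.
- by move=> *; exact: Thom_eq.
- by move=> *; exact: Thom_eq.
- by move=> *; exact: Thom_eq.
- move=> A B D.
  apply: (strict_iso (A := box0 A (box0 B D)) (B := box0 (box0 A B) D)
    (g := fun p => (p.1.1, (p.1.2, p.2)))).
  + exact: upsilon_strict.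
  + by case=> x [].
  + by case=> [[]].
- move=> A; apply: (strict_iso (A := A) (B := box0 A E) (g := fst)).
  + exact: lambda_strict.
  + by [].
  + by case=> x [].
- move=> A; apply: (strict_iso (A := A) (B := box0 E A) (g := snd)).
  + exact: rho_strict.
  + by [].
  + by case=> [[]].
- by move=> *; exact: Thom_eq.
- by move=> *; exact: Thom_eq.
Qed.
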